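(* Let $S$ be an inverse semigroup without zero with $|S/\sigma| \ge 2$. The zero-divisor graph $\Gamma(S^0)$ is the union of the complete bipartite graphs $K_{a\sigma, b\sigma}$, where $(a,b) \notin \sigma$ and $a\sigma$ and $b\sigma$ are the two partition classes of $K_{a\sigma, b\sigma}$; that is, $$\Gamma(S^0) = \bigcup_{a, b \in S,\ (a,b) \notin \sigma} K_{a\sigma, b\sigma}.$$
   Context: For an inverse semigroup $T$ with set of idempotents $E(T)$, the natural partial order is: $a \le b$ iff $a = eb$ for some $e \in E(T)$. A semigroup ''with zero'' is one with at least two elements containing an element $0$ such that $0x = x0 = 0$ for all $x$; thus a one-element semigroup counts as being without zero. If $S$ has no zero, $S^0 = S \cup \{0\}$ denotes $S$ with an external zero adjoined. For an inverse semigroup $T$ with zero and $a, b \in T$, $\omega(a,b) = \{c \in T : c \le a \text{ and } c \le b\}$. The zero-divisor graph $\Gamma(T)$ is the simple undirected graph with vertex set $Z(T)^\times = \{a \in T\setminus\{0\} : \exists\, b \in T \setminus\{0\},\ \omega(a,b) = \{0\}\}$, in which two distinct vertices $a, b$ are adjacent iff $\omega(a,b) = \{0\}$. The least group congruence $\sigma$ on $S$ is given by: $a\,\sigma\,b$ iff $ea = fb$ for some $e, f \in E(S)$; $a\sigma$ denotes the $\sigma$-class of $a$. For disjoint sets $X, Y$, $K_{X,Y}$ is the complete bipartite graph with vertex set $X \cup Y$ whose edges are exactly the pairs $\{x,y\}$ with $x\in X$, $y \in Y$. The union of graphs is the graph whose vertex set is the union of the vertex sets and whose edge set is the union of the edge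 sets. *)

(* Defs.v *)
From HB Require Import structures.
From mathcomp Require Import all_boot.
From mathcomp Require Import boolp classical_sets functions cardinality.

Set Implicit Arguments.
Unset Strict Implicit.
Unset Printing Implicit Defensive.

Local Open Scope classical_set_scope.
Local Open Scope group_scope.

Definition inverse_semigroup (S : semigroupType) : Prop :=
  forall a : S, exists! b : S, a * b * a = a /\ b * a * b = b.

Definition idem (S : semigroupType) : set S := [set e | e * e = e].
Arguments idem : clear implicits.

Definition is_zero (S : semigroupType) (z : S) : Prop :=
  forall x : S, z * x = z /\ x * z = z.

(* The one-element semigroup counts as being without zero. *)
Definition with_zero (S : semigroupType) : Prop :=
  (exists x y : S, x <> y) /\ exists z : S, is_zero z.

Definition nat_le (S : semigroupType) (a b : S) : Prop :=
  exists2 e, idem S e & a = e * b.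

Definition omega (S : semigroupType) (a b : S) : set S :=
  [set c | nat_le c a /\ nat_le c b].

Definition adjoin_zero (S : Type) : Type := option S.

HB.instance Definition _ (S : choiceType) :=
  Choice.copy (adjoin_zero S) (option S).

Definition adjoined_zero (S : Type) : adjoin_zero S := None.
Arguments adjoined_zero : clear implicits.

Definition to_adjoin_zero (S : Type) (x : S) : adjoin_zero S := Some x.

Definition adjoin_zero_mul (S : semigroupType) (x y : adjoin_zero S) :
    adjoin_zero S :=
  match x, y with
  | Some a, Some b => Some (a * b)
  | _, _ => None
  end.

Lemma adjoin_zero_mulA (S : semigroupType) :
  associative (@adjoin_zero_mul S).
Proof. by move=> [x|] [y|] [z|] //=; rewrite mulgA. Qed.

HB.instance Definition _ (S : semigroupType) :=
  isSemigroup.Build (adjoin_zero S) (@adjoin_zero_mulA S).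

Lemma adjoined_zero_is_zero (S : semigroupType) :
  is_zero (adjoined_zero S).
Proof. by case. Qed.

Lemma adjoin_zero_inverse_semigroup (S : semigroupType) :
  inverse_semigroup S -> inverse_semigroup (adjoin_zero S).
Proof.
move=> S_inv [a|]; last first.
  by exists None; split=> // -[b|] [].
have [b [[aba bab] b_uniq]] := S_inv a.
exists (Some b); split; first by split; congr Some.
by case=> [c|] [//= [aca] [cac]]; rewrite (b_uniq c).
Qed.

Definition sigma (S : semigroupType) (a b : S) : Prop :=
  exists e f, [/\ idem S e, idem S f & e * a = f * b].

Definition sigma_class (S : semigroupType) (a : S) : set S :=
  [set b | sigma a b].

Definition sigma_quotient (S : semigroupType) : set (set S) :=
  range (@sigma_class S).
Arguments sigma_quotient : clear implicits.

Section SigmaEquivalence.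
Variables (S : semigroupType) (S_inv : inverse_semigroup S).

Let inverse_uniq (a b c : S) :
  a * b * a = a -> b * a * b = b -> a * c * a = a -> c * a * c = c -> b = c.
Proof.
move=> aba bab aca cac; have [d [_ d_uniq]] := S_inv a.
by rewrite -(d_uniq b) // -(d_uniq c).
Qed.

Lemma idemM e f : idem S e -> idem S f -> idem S (e * f).
Proof.
rewrite /idem/= => ee ff; have [x [[x1 x2] _]] := S_inv (e * f).
have xE : f * x * e = x.
  apply: (@inverse_uniq (e * f)) => //.
    by rewrite -[RHS]x1 !mulgA -(mulgA e f f) ff -(mulgA _ e e) ee.
  rewrite -[in RHS]x2 !mulgA -(mulgA _ e e) ee.
  by rewrite -(mulgA _ f f) ff.
have xx : x * x = x.
  rewrite -[in LHS]xE -[RHS]xE -[in RHS]x2 !mulgA.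
  by rewrite -!mulgA.
suff <- : x = e * f by [].
by apply: (@inverse_uniq x); rewrite ?xx.
Qed.

Lemma idemC e f : idem S e -> idem S f -> e * f = f * e.
Proof.
move=> ee ff; have := idemM ff ee; have := idemM ee ff.
move: ee ff; rewrite /idem/= => ee ff efef fefe.
apply: (@inverse_uniq (e * f)); rewrite ?efef //.
  by rewrite !mulgA -(mulgA e f f) ff -(mulgA _ e e) ee -mulgA efef.
by rewrite !mulgA -(mulgA f e e) ee -(mulgA _ f f) ff -mulgA fefe.
Qed.

Lemma sigma_refl (a : S) : sigma a a.
Proof.
have [b [[aba _] _]] := S_inv a.
by exists (a * b), (a * b); split; rewrite // /idem/= mulgA aba.
Qed.

Lemma sigma_sym (a b : S) : sigma a b -> sigma b a.
Proof. by move=> [e [f [ee ff eafb]]]; exists f, e. Qed.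

Lemma sigma_trans (b a c : S) : sigma a b -> sigma b c -> sigma a c.
Proof.
move=> [e [f [ee ff eafb]]] [g [h [gg hh gbhc]]].
exists (g * e), (f * h); split; [exact: idemM | exact: idemM |].
by rewrite -!mulgA eafb -gbhc !mulgA (idemC gg ff).
Qed.

End SigmaEquivalence.

Record simple_graph (V : Type) := SimpleGraph {
  vertices : set V;
  edges : set (set V);
  edgesP : forall e, edges e ->
    exists x y, [/\ vertices x, vertices y, x <> y & e = [set x; y]]
}.

Section CompleteBipartite.
Variables (V : Type) (X Y : set V) (dXY : [disjoint X & Y]).

Let K_edges : set (set V) :=
  [set e | exists x y, [/\ X x, Y y & e = [set x; y]]].

Let K_edgesP e : K_edges e ->
  exists x y, [/\ (X `|` Y) x, (X `|` Y) y, x <> y & e = [set x; y]].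
Proof.
move=> [x [y [Xx Yy ->]]]; exists x, y; split; [by left | by right | | by []].
move=> xy; move/eqP: dXY; rewrite -subset0; apply.
by split; [exact: Xx | rewrite xy].
Qed.

Definition complete_bipartite : simple_graph V := SimpleGraph K_edgesP.

End CompleteBipartite.

Section GraphUnion.
Variables (V I : Type) (G : I -> simple_graph V).

Let U_vertices : set V := \bigcup_i vertices (G i).
Let U_edges : set (set V) := \bigcup_i edges (G i).

Let U_edgesP e : U_edges e ->
  exists x y, [/\ U_vertices x, U_vertices y, x <> y & e = [set x; y]].
Proof.
move=> [i _ /edgesP[x [y [Gx Gy xy ->]]]].
by exists x, y; split=> //; exists i.
Qed.

Definition graph_union : simple_graph V := SimpleGraph U_edgesP.

End GraphUnion.

Section ZeroDivisorGraph.
Variables (T : semigroupType) (z : T).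

Definition zero_divisors : set T :=
  [set a | a <> z /\ exists2 b, b <> z & omega a b = [set z]].

Let Gamma_edges : set (set T) :=
  [set e | exists a b, [/\ zero_divisors a, zero_divisors b, a <> b,
                          omega a b = [set z] & e = [set a; b]]].

Let Gamma_edgesP e : Gamma_edges e ->
  exists x y, [/\ zero_divisors x, zero_divisors y, x <> y & e = [set x; y]].
Proof. by move=> [a [b [Za Zb ab _ ->]]]; exists a, b. Qed.

(* Meant for z the zero of T. *)
Definition zero_divisor_graph : simple_graph T := SimpleGraph Gamma_edgesP.

End ZeroDivisorGraph.

Section SigmaBipartite.
Variables (S : semigroupType) (S_inv : inverse_semigroup S).
Variables (a b : S) (ab : ~ sigma a b).

Lemma sigma_class_disjoint :
  [disjoint @to_adjoin_zero S @` sigma_class a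
          & @to_adjoin_zero S @` sigma_class b].
Proof.
apply/eqP; rewrite -subset0 => _ [[c ac <-] [d bd [dc]]]; apply: ab.
apply: (sigma_trans S_inv ac); apply: sigma_sym.
by rewrite -dc.
Qed.

(* The complete bipartite graph on the sigma-classes of a and b, drawn inside
   the vertex type of the zero-divisor graph of S with a zero adjoined. *)
Definition sigma_bipartite : simple_graph (adjoin_zero S) :=
  complete_bipartite sigma_class_disjoint.

End SigmaBipartite.

(* Main.v *)
(* Since e * a = f * b is exactly a common lower bound of a and b, two elements
   of S meet only in 0 in the semigroup S^0 iff they lie in distinct
   sigma-classes; both graphs are then described by this relation. *)
Require Import Defs.
From mathcomp Require Import all_boot.
From mathcomp Require Import boolp classical_sets functions cardinality.

Local Open Scope classical_set_scope.
Local Open Scope card_scope.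

(** The only other field, [edgesP], is a proof, so proof irrelevance settles it. *)
Lemma simple_graph_eq (V : Type) (G H : simple_graph V) :
  vertices G = vertices H -> edges G = edges H -> G = H.
Proof.
case: G H => [vG eG pG] [vH eH pH] /= vE eE; subst.
by congr SimpleGraph; exact: Prop_irrelevance.
Qed.

(** An idempotent witnessing the left-hand side cannot be the adjoined zero, since its product with
    [b] must be an element of [S]. *)
Lemma nat_le_to_adjoin_zero (S : semigroupType) (a b : S) :
  nat_le (to_adjoin_zero a) (to_adjoin_zero b) <-> nat_le a b.
Proof.
split=> [[[e|] //= [ee] [->]]|[e ee ->]]; first by exists e.
by exists (to_adjoin_zero e) => //; congr Some.
Qed.

Lemma adjoined_zero_nat_le (S : semigroupType) (x : adjoin_zero S) :
  nat_le (adjoined_zero S) x.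
Proof. by exists (adjoined_zero S). Qed.

Lemma sigma_nat_le (S : semigroupType) (a b : S) :
  sigma a b <-> exists c, nat_le c a /\ nat_le c b.
Proof.
split=> [[e [f [ee ff eafb]]]|[_ [[e ee ->] [f ff eafb]]]].
  by exists (e * a)%g; split; [exists e | exists f].
by exists e, f.
Qed.

(** The adjoined zero lies below everything, so only a common lower bound inside [S] can make
    [omega] larger, and such a bound is what [sigma] asserts. *)
Lemma omega_to_adjoin_zero (S : semigroupType) (a b : S) :
  omega (to_adjoin_zero a) (to_adjoin_zero b) = [set adjoined_zero S] <->
  ~ sigma a b.
Proof.
split=> [omega0 /sigma_nat_le[c [ca cb]]|nab].
  have : omega (to_adjoin_zero a) (to_adjoin_zero b) (to_adjoin_zero c).
    by split; apply/nat_le_to_adjoin_zero.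
  by rewrite omega0.
apply/seteqP; split=> [[c|//] [ca cb]|_ ->]; last first.
  by split; exact: adjoined_zero_nat_le.
by case: nab; apply/sigma_nat_le; exists c; split;
  apply/nat_le_to_adjoin_zero.
Qed.

Lemma zero_divisors_to_adjoin_zero (S : semigroupType) (a : S) :
  zero_divisors (adjoined_zero S) (to_adjoin_zero a) <->
  exists b, ~ sigma a b.
Proof.
split=> [[_ [[b|//] _ /omega_to_adjoin_zero nab]]|[b nab]]; first by exists b.
by split=> //; exists (to_adjoin_zero b) => //; apply/omega_to_adjoin_zero.
Qed.

Theorem theorem4p3 (S : semigroupType) (S_inv : inverse_semigroup S)
    (S_without_zero : ~ with_zero S)
    (S_sigma_ge2 : `I_2 #<= sigma_quotient S) :
  zero_divisor_graph (adjoined_zero S) =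
  graph_union (fun p : {ab : S * S | ~ sigma ab.1 ab.2} =>
    sigma_bipartite S_inv (proj2_sig p)).
Proof.
have nsigmaC (a b : S) : ~ sigma a b -> ~ sigma b a.
  by move=> nab /sigma_sym.
have nsigmaS (a b c : S) : sigma a c -> ~ sigma a b -> ~ sigma c b.
  by move=> ac nab cb; apply: nab; exact: (sigma_trans S_inv ac cb).
apply: simple_graph_eq; apply/seteqP; split.
- case=> [c|[]//] /zero_divisors_to_adjoin_zero[d ncd].
  (* The vertex [c] and its partner [d] themselves serve as class representatives. *)
  exists (exist _ (c, d) ncd) => //; left.
  by exists c => //; exact: (sigma_refl S_inv).
- move=> _ [[[a b] /= nab] _ [[c ac <-]|[c bc <-]]].
    by apply/zero_divisors_to_adjoin_zero; exists b; exact: (nsigmaS _ _ _ ac).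
  apply/zero_divisors_to_adjoin_zero; exists a.
  by apply: (nsigmaS _ _ _ bc); exact: nsigmaC.
(* Zero divisors are nonzero by definition, so both endpoints come from [S]. *)
- move=> _ [[c|] [[d|] [[]// _ _ []// _ _ _ /omega_to_adjoin_zero ncd ->]]].
  exists (exist _ (c, d) ncd) => //.
  by exists (to_adjoin_zero c), (to_adjoin_zero d); split=> //;
    [exists c | exists d] => //; exact: (sigma_refl S_inv).
- move=> _ [[[a b] /= nab] _ [_ [_ [[c ac <-] [d bd <-] ->]]]].
  (* Transport [~ sigma a b] along [sigma a c] and [sigma b d], one side at a time, using symmetry
     to reach the second argument. *)
  have ncd : ~ sigma c d.
    apply: (nsigmaS _ _ _ ac); apply: (nsigmaC _ _).
    by apply: (nsigmaS _ _ _ bd); exact: nsigmaC.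
  exists (to_adjoin_zero c), (to_adjoin_zero d); split=> //.
  + by apply/zero_divisors_to_adjoin_zero; exists d.
  + by apply/zero_divisors_to_adjoin_zero; exists c; exact: nsigmaC.
  + by case=> cd; apply: ncd; rewrite cd; exact: (sigma_refl S_inv).
  + exact/omega_to_adjoin_zero.
Qed.
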